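(* Let $p>1$, let $f,F$ be real numbers with $0<f^p\leq F$, and let $k\in(0,1]$. Consider \[ S_k(f,F)=\sup\left\{\int_0^k\left(\frac1t\int_0^t g(u)\,du\right)^p dt \;:\; g:(0,1]\to[0,+\infty)\ \text{non-increasing},\ \int_0^1 g=f,\ \int_0^1 g^p=F\right\}. \] Then there exists a function $g=g_k:(0,1]\to[0,+\infty)$ which is non-increasing and continuous, satisfies $\int_0^1 g=f$ and $\int_0^1 g^p=F$, and for which $\int_0^k\left(\frac1t\int_0^t g\right)^p dt=S_k(f,F)$, i.e. the supremum is attained.
   Context: In the paper this supremum equals the Bellman function $B_p^{\mathcal T}(f,F,k)$ of the dyadic maximal operator on a tree, but the claim above is purely about functions on $(0,1]$ with Lebesgue measure. *)

(* Defs.v *)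
From HB Require Import structures.
From mathcomp Require Import all_boot all_order all_algebra.
From mathcomp Require Import all_classical all_reals all_analysis.
Set Implicit Arguments. Unset Strict Implicit. Unset Printing Implicit Defensive.
Import Order.TTheory GRing.Theory Num.Theory numFieldNormedType.Exports.
Local Open Scope classical_set_scope.
Local Open Scope ring_scope.

(* Admissible functions: g : (0,1] -> [0,+oo) non-increasing with
   int_0^1 g = f and int_0^1 g^p = F (values of g outside (0,1] are irrelevant). *)
Definition admissible (R : realType) (p f F : R) (g : R -> R) : Prop :=
  [/\ (forall x, x \in `]0, 1]%classic -> 0 <= g x),
      (forall x y, x \in `]0, 1]%classic -> y \in `]0, 1]%classic ->
                   x <= y -> g y <= g x),
      (\int[@lebesgue_measure R]_(x in `]0%R, 1%R]) (g x)%:E = f%:E)%E &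
      (\int[@lebesgue_measure R]_(x in `]0%R, 1%R]) (powR (g x) p)%:E = F%:E)%E ].

Definition hardy_avg (R : realType) (g : R -> R) (t : R) : \bar R :=
  ((t^-1)%:E * \int[@lebesgue_measure R]_(u in `]0%R, t]) (g u)%:E)%E.

Definition hardy_functional (R : realType) (p k : R) (g : R -> R) : \bar R :=
  (\int[@lebesgue_measure R]_(t in `]0%R, k]) poweR (hardy_avg g t) p)%E.

Definition S_k (R : realType) (p k f F : R) : \bar R :=
  ereal_sup [set hardy_functional p k g | g in [set g | admissible p f F g]].

(* Main.v *)
(** For [a > 1], Young's inequality [p x y^(p-1) <= a^(p-1) x^p + (p-1)/a y^p] with [x = g]
    and [y] the Hardy average [A] of [g], together with the identity
    [(t A^p)' = p A^(p-1) g - (p-1) A^p], yields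
      [(p-1)(1-1/a) int_0^k A^p <= a^(p-1) int_0^k g^p - k A(k)^p].
    Estimating [int_k^1 g^p] from below by Young's inequality at a constant [M], and
    [A(k)^p] from below by its tangent at [a M], the unknown [A(k)] cancels and a bound
    depending only on [p, f, F, k] remains.  Equality holds throughout for
    [g(t) = M (min(t,k)/k)^(1/a-1)], and the two integral constraints determine [a] and [M];
    [a] exists by the intermediate value theorem.  When [F = f^p] this forces [a = 1]; then the
    strict form of Young's inequality shows that every admissible function is a.e. equal to [f]. *)

Require Import Defs.
From HB Require Import structures.
From mathcomp Require Import all_boot all_order all_algebra.
From mathcomp Require Import all_classical all_reals all_analysis.
From mathcomp Require Import measurable_realfun.
From mathcomp Require Import ring lra.
Import Order.TTheory GRing.Theory Num.Theory numFieldNormedType.Exports.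
Local Open Scope classical_set_scope.
Local Open Scope ring_scope.

Set Implicit Arguments.
Unset Strict Implicit.
Unset Printing Implicit Defensive.

(** * Young's inequality for real powers *)

(** Strict weighted AM-GM for [x^p] and [y^p] with weights [1/p] and [(p-1)/p]. With [m] the
    arithmetic mean and [L = ln m], apply [1 + u <= expR u] at [a - L] and [b - L]: the exponentials
    have weighted sum [p], and since [a != b] at least one of the two inequalities is strict. *)
Lemma powR_tangent_lt (R : realType) (p x y : R) :
  1 < p -> 0 <= x -> 0 < y -> x != y ->
  p * (x * y `^ (p - 1)) < x `^ p + (p - 1) * y `^ p.
Proof.
move=> p1 x0 y0 xy; have p0 : 0 < p by lra.
have [x00|xn0] := eqVneq x 0.
  rewrite x00 mul0r mulr0 powR0 ?gt_eqF// add0r mulr_gt0 ?powR_gt0//; lra.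
have {xn0}x0 : 0 < x by rewrite lt0r xn0.
have xpE : x `^ p = expR (p * ln x) by rewrite /powR gt_eqF.
have ypE : y `^ p = expR (p * ln y) by rewrite /powR gt_eqF.
set m := (x `^ p + (p - 1) * y `^ p) / p.
have m0 : 0 < m by rewrite divr_gt0// addr_gt0 ?mulr_gt0 ?powR_gt0//; lra.
have xyE : x * y `^ (p - 1) = expR ((p * ln x + (p - 1) * (p * ln y)) / p).
  rewrite -{1}[x]lnK ?posrE// /powR gt_eqF// -expRD; congr expR.
  by field; rewrite gt_eqF.
suff : x * y `^ (p - 1) < m by rewrite ltr_pdivlMr// mulrC.
rewrite -[m]lnK ?posrE// xyE ltr_expR ltr_pdivrMr//.
set L := ln m; set a := p * ln x; set b := p * ln y.
have ab : a != b.
  apply: contra xy => /eqP/(mulfI (lt0r_neq0 p0)) E.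
  by apply/eqP; apply: ln_inj; rewrite ?posrE.
have E : expR (a - L) + (p - 1) * expR (b - L) = p.
  rewrite !expRB -xpE -ypE (lnK m0) /m.
  field; rewrite !gt_eqF//= addr_gt0 ?mulr_gt0 ?powR_gt0//; lra.
have A := expR_ge1Dx (a - L); have B := expR_ge1Dx (b - L).
have [aL|aL] := eqVneq (a - L) 0.
  have /expR_gt1Dx : b - L != 0.
    by apply: contra ab => /eqP bL; apply/eqP; lra.
  rewrite -(ltr_pM2l (x := p - 1)); last by lra.
  by move=> {}B; lra.
have {}B : (p - 1) * (1 + (b - L)) <= (p - 1) * expR (b - L) by rewrite ler_pM2l; lra.
have := expR_gt1Dx aL; lra.
Qed.

Lemma powR_tangent (R : realType) (p x y : R) :
  1 < p -> 0 <= x -> 0 <= y ->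
  p * (x * y `^ (p - 1)) <= x `^ p + (p - 1) * y `^ p.
Proof.
move=> p1 x0; have p0 : 0 < p by lra.
rewrite le_eqVlt => /predU1P[<-|y0].
  rewrite !powR0 ?mulr0 ?addr0 ?powR_ge0// ?gt_eqF//; lra.
have [->|xy] := eqVneq x y; last exact/ltW/powR_tangent_lt.
rewrite mulr_powRB1//; [lra|exact: ltW].
Qed.

(** * Measurability, integrability and primitives of admissible functions *)

(** The sets where [h] is at least [r] are intervals, and the rays [[r, +oo[] generate the Borel
    sets. *)
Lemma nonincreasing_in_measurable (R : realType) (D : set R) (h : R -> R) :
  is_interval D -> {in D &, nonincreasing_fun h} -> measurable_fun D h.
Proof.
move=> iD hD; have mD := is_interval_measurable iD.
apply: (measurability (@RGenCInfty.G R)) => [|/= _ [_] [r] -> <-].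
  exact: RGenCInfty.measurableE.
apply: is_interval_measurable => x y/=.
rewrite !in_itv/= !andbT => -[Dx hx] [Dy hy] z /andP[xz zy].
have Dz : D z by apply: (iD x y) => //; rewrite xz.
by split => //; rewrite in_itv/= andbT (le_trans hy)// hD// inE.
Qed.

(** Real-valued so that [lra] and [ring] apply. An infinite integral would be sent to 0, so the
    values are meaningful for integrable [g]; [hardy_avgE] links them to [hardy_avg]. *)
Definition primitive (R : realType) (g : R -> R) (t : R) : R :=
  \int[@lebesgue_measure R]_(x in `]0, t]) g x.

Lemma nonneg_integrable (R : realType) (D : set R) (h : R -> R) (v : R) :
  measurable D -> measurable_fun D h -> (forall x, D x -> 0 <= h x) ->
  (\int[@lebesgue_measure R]_(x in D) (h x)%:E = v%:E)%E ->
  (@lebesgue_measure R).-integrable D (EFin \o h).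
Proof.
move=> mD mh h0 hv; apply/integrableP; split; first exact/measurable_EFinP.
under eq_integral => x /set_mem Dx.
  by rewrite /= ger0_norm; [over|exact: h0].
by rewrite hv ltry.
Qed.

Section admissible_theory.
Context {R : realType}.
Notation mu := (@lebesgue_measure R).

Lemma admissible_measurable (p f F : R) (g : R -> R) :
  admissible p f F g -> measurable_fun `]0, 1 : R] g.
Proof.
move=> [g0 gni _ _]; apply: nonincreasing_in_measurable; first exact: interval_is_interval.
by move=> x y xI yI xy; exact: gni.
Qed.

Lemma admissible_integrable (p f F : R) (g : R -> R) :
  admissible p f F g -> mu.-integrable `]0, 1 : R] (EFin \o g).
Proof.
move=> adm; have mg := admissible_measurable adm.
case: adm => g0 _ gf _.
by apply: (nonneg_integrable _ mg _ gf) => // x xI; apply: g0; rewrite inE.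
Qed.

Lemma admissible_powR_integrable (p f F : R) (g : R -> R) :
  admissible p f F g -> mu.-integrable `]0, 1 : R] (EFin \o (fun x => g x `^ p)).
Proof.
move=> adm; have mg := admissible_measurable adm.
case: adm => g0 _ _ gF.
apply: (nonneg_integrable _ _ _ gF) => //; last by move=> x _; exact: powR_ge0.
exact: (measurableT_comp (measurable_powR p) mg).
Qed.

Lemma primitiveB (h : R -> R) (s t : R) :
  mu.-integrable `]0, 1 : R] (EFin \o h) -> 0 <= s <= t -> t <= 1 ->
  primitive h t - primitive h s = \int[mu]_(x in `]s, t]) h x.
Proof.
move=> ih /andP[s0 st] t1; rewrite /primitive Rintegral_itvB ?bnd_simp//.
by apply: integrableS ih => //; apply: subset_itvl; rewrite bnd_simp.
Qed.

Lemma primitive0 (h : R -> R) : primitive h 0 = 0.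
Proof. by rewrite /primitive set_itv_ge ?Rintegral_set0// bnd_simp ltxx. Qed.

Lemma admissible_primitive1 (p f F : R) (g : R -> R) :
  admissible p f F g -> primitive g 1 = f.
Proof. by case=> _ _ gf _; rewrite /primitive /Rintegral gf. Qed.

Lemma admissible_primitive_powR1 (p f F : R) (g : R -> R) :
  admissible p f F g -> primitive (fun x => g x `^ p) 1 = F.
Proof. by case=> _ _ _ gF; rewrite /primitive /Rintegral gF. Qed.

Lemma admissible_primitive_le (p f F : R) (g : R -> R) (s t : R) :
  admissible p f F g -> 0 <= s <= t -> t <= 1 ->
  primitive g s <= primitive g t.
Proof.
move=> adm st t1; rewrite -subr_ge0 (primitiveB (admissible_integrable adm))//.
apply: Rintegral_ge0 => x /=; rewrite in_itv/= => /andP[sx xt].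
case: adm => + _ _ _; apply; rewrite inE/= in_itv/=; lra.
Qed.

Lemma hardy_avgE (p f F : R) (g : R -> R) (t : R) :
  admissible p f F g -> 0 < t -> t <= 1 ->
  hardy_avg g t = (primitive g t / t)%:E.
Proof.
move=> adm t0 t1; rewrite /hardy_avg mulrC EFinM /primitive /Rintegral fineK//.
apply: integrable_fin_num => //; apply: integrableS (admissible_integrable adm) => //.
by apply: subset_itvl; rewrite bnd_simp.
Qed.

(** The pointwise inequality [powR_tangent] at a constant [y], integrated over []s, t]]. It serves
    three times: with [y] the average divided by [a], with [y] the average itself (Jensen), and with
    [y = M] on []k, 1]]. *)
Lemma young_increment (p f F : R) (g : R -> R) (s t y : R) :
  1 < p -> admissible p f F g -> 0 <= s <= t -> t <= 1 -> 0 <= y ->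
  p * y `^ (p - 1) * (primitive g t - primitive g s) <=
  primitive (fun x => g x `^ p) t - primitive (fun x => g x `^ p) s
  + (p - 1) * y `^ p * (t - s).
Proof.
move=> p1 adm st t1 y0; have ig := admissible_integrable adm.
have iP := admissible_powR_integrable adm.
rewrite !primitiveB//.
have sub : `]s, t] `<=` `]0, 1].
  move=> x /=; rewrite !in_itv/=; lra.
have {}ig : mu.-integrable `]s, t] (EFin \o g) by exact: integrableS ig.
have {}iP : mu.-integrable `]s, t] (EFin \o (fun x => g x `^ p)) by exact: integrableS iP.
have mst : mu `]s, t] = (t - s)%:E.
  rewrite lebesgue_measure_itv/= lte_fin.
  by case: ltP => // ?; congr EFin; lra.
have ic c : mu.-integrable `]s, t] (EFin \o (fun=> c)).
  apply/integrableP; split; first exact/measurable_EFinP.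
  by rewrite (integral_cst _ _ (`|c|%:E)%E)//= mst -EFinM ltry.
have -> : (p - 1) * y `^ p * (t - s) = \int[mu]_(x in `]s, t]) ((p - 1) * y `^ p).
  rewrite Rintegral_cst//. congr (_ * _); exact: (esym (congr1 fine mst)).
rewrite -RintegralD// -RintegralZl//; apply: le_Rintegral => //.
- exact: integrableZl ig.
- exact: integrableD iP (ic _).
- move=> x xI; rewrite -mulrA [_ * g x]mulrC; apply: powR_tangent => //.
  by case: adm => + _ _ _; apply; rewrite inE; exact: sub.
Qed.

End admissible_theory.

(** * Upper bound *)

Section hardy_bound.
Context {R : realType}.
Notation mu := (@lebesgue_measure R).

Definition average (g : R -> R) (t : R) : R := primitive g t / t.

Lemma admissible_primitive_ge0 (p f F : R) (g : R -> R) (t : R) :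
  admissible p f F g -> 0 <= t -> t <= 1 -> 0 <= primitive g t.
Proof.
move=> adm t0 t1; rewrite -(primitive0 g).
by apply: (admissible_primitive_le adm); rewrite ?lexx ?t0.
Qed.

Lemma average_ge0 (p f F : R) (g : R -> R) (t : R) :
  admissible p f F g -> 0 <= t -> t <= 1 -> 0 <= average g t.
Proof. by move=> adm t0 t1; rewrite divr_ge0 ?(admissible_primitive_ge0 adm). Qed.

(* Discrete form of [(t A^p)' = p A^(p-1) g - (p-1) A^p]: the perspective
   [(t, y) |-> y^p t^(1-p)] is convex, so its tangent at [(t, primitive g t)] bounds the
   increment for every step, and no differentiation of the primitive is needed. *)
Lemma average_powR_step (p f F a : R) (g : R -> R) (s t : R) :
  1 < p -> 0 < a -> admissible p f F g -> 0 < s -> s <= t -> t <= 1 ->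
  t * average g t `^ p + (p - 1) * (1 - a^-1) * average g t `^ p * (t - s) <=
  s * average g s `^ p + a `^ (p - 1) *
    (primitive (fun x => g x `^ p) t - primitive (fun x => g x `^ p) s).
Proof.
move=> p1 a0 adm s0 st t1.
have t0 : 0 < t by exact: lt_le_trans st.
have At0 : 0 <= average g t by exact: (average_ge0 adm (ltW t0)).
have As0 : 0 <= average g s by apply: (average_ge0 adm); lra.
(* The tangent inequality of the perspective, written with averages. *)
have T1 : s * (p * (average g s * average g t `^ (p - 1))) <=
    s * (average g s `^ p + (p - 1) * average g t `^ p).
  by rewrite ler_pM2l//; exact: powR_tangent.
have sE : primitive g s = s * average g s by rewrite /average mulrC divfK ?gt_eqF.
have tE : primitive g t = t * average g t by rewrite /average mulrC divfK ?gt_eqF.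
have T2 : average g t * average g t `^ (p - 1) = average g t `^ p.
  by rewrite mulr_powRB1//; lra.
have aM : a `^ p = a * a `^ (p - 1) by rewrite mulr_powRB1 ?(ltW a0)//; lra.
(* Young's inequality is taken at [y = average g t / a] and multiplied by [a^(p-1)], which leaves
   [average g t] to the power [p-1] on the left and a factor [1/a] in the last term. *)
have ya0 : 0 <= average g t / a by rewrite divr_ge0 ?(ltW a0).
have st' : 0 <= s <= t by rewrite (ltW s0) st.
have := young_increment p1 adm st' t1 ya0.
rewrite -(ler_pM2l (powR_gt0 (p - 1) a0)) sE tE.
have ai0 : 0 <= a^-1 by rewrite invr_ge0 ltW.
have aV x : a^-1 `^ x = (a `^ x)^-1 by rewrite -powR_inv1 ?ltW// -powRrM mulN1r powRN.
have ap0 : a `^ (p - 1) != 0 by rewrite gt_eqF// powR_gt0.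
rewrite (powRM (p - 1) At0 ai0) (powRM p At0 ai0) !aV aM.
move=> LU; set Q1 := primitive _ t in LU *; set Q2 := primitive _ s in LU *.
set L := (X in X <= _) in LU; set U := (X in _ <= X) in LU.
have LE : L = p * average g t `^ (p - 1) * (t * average g t - s * average g s).
  by rewrite /L; field.
have UE : U = a `^ (p - 1) * (Q1 - Q2) + (p - 1) * average g t `^ p * a^-1 * (t - s).
  by rewrite /U; field; rewrite ap0 gt_eqF.
rewrite LE UE in LU.
have T3 : t * average g t `^ p = average g t `^ (p - 1) * (t * average g t).
  by rewrite -T2; ring.
have T4 : p * average g t `^ (p - 1) * (t * average g t) = p * (t * average g t `^ p).
  by rewrite T3; ring.
move: LU T1; rewrite mulrBr T4; lra.
Qed.

(** Jensen's inequality, obtained from Young's at [y = average g t]. It controls the boundary term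
    near 0 in [hardy_functional_le]. *)
Lemma average_powR_le (p f F : R) (g : R -> R) (t : R) :
  1 < p -> admissible p f F g -> 0 < t -> t <= 1 ->
  t * average g t `^ p <= primitive (fun x => g x `^ p) t.
Proof.
move=> p1 adm t0 t1.
have At0 : 0 <= average g t by exact: (average_ge0 adm (ltW t0)).
have t00 : (0 : R) <= 0 <= t by rewrite lexx ltW.
have := young_increment p1 adm t00 t1 At0.
rewrite !primitive0 !subr0.
have tE : primitive g t = t * average g t by rewrite /average mulrC divfK ?gt_eqF.
have T2 : average g t * average g t `^ (p - 1) = average g t `^ p.
  by rewrite mulr_powRB1//; lra.
rewrite tE (_ : _ * (t * _) = p * (t * average g t `^ p)); first lra.
by rewrite -T2; ring.
Qed.

Lemma measurable_average_powR (p f F : R) (g : R -> R) :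
  admissible p f F g -> measurable_fun `]0, 1 : R] (fun t => average g t `^ p).
Proof.
move=> adm; apply: (measurableT_comp (measurable_powR p)).
apply: measurable_funM.
  rewrite (_ : primitive g = \- (\- primitive g)); last by apply/funext => x /=; rewrite opprK.
  apply: measurableT_comp => //.
  apply: nonincreasing_in_measurable; first exact: interval_is_interval.
  move=> x y; rewrite !inE/= !in_itv/= => /andP[x0 x1] /andP[y0 y1] xy.
  by rewrite lerN2; apply: (admissible_primitive_le adm) => //; rewrite ltW.
apply: nonincreasing_in_measurable; first exact: interval_is_interval.
move=> x y; rewrite !inE/= !in_itv/= => /andP[x0 x1] /andP[y0 y1] xy.
by rewrite lef_pV2 ?posrE.
Qed.

Lemma hardy_functionalE (p k f F : R) (g : R -> R) :
  admissible p f F g -> k <= 1 ->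
  hardy_functional p k g = (\int[mu]_(t in `]0%R, k]) (average g t `^ p)%:E)%E.
Proof.
move=> adm k1; apply: eq_integral => t; rewrite inE/= in_itv/= => /andP[t0 tk].
by rewrite (hardy_avgE adm)// ?poweR_EFin//; exact: le_trans k1.
Qed.

(** On the slab the primitive is at most [primitive g t] and the denominator is above [t * r], so
    the average is at most [average g t / r]. *)
Lemma integral_average_slab (p f F r t : R) (g : R -> R) :
  1 < p -> admissible p f F g -> 0 < r -> r < 1 -> 0 < t -> t <= 1 ->
  (\int[mu]_(u in `](t * r)%R, t]) (average g u `^ p)%:E <=
   (average g t `^ p / r `^ p * (t - t * r))%:E)%E.
Proof.
move=> p1 adm r0 r1 t0 t1; have p0 : 0 <= p by lra.
have tr0 : 0 < t * r by exact: mulr_gt0.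
have trt : t * r < t by rewrite gtr_pMr.
have sub : `]t * r, t] `<=` `]0, 1].
  by move=> u /=; rewrite !in_itv/=; lra.
apply: (@le_trans _ _ (\int[mu]_(u in `](t * r)%R, t]) (average g t `^ p / r `^ p)%:E)%E).
  apply: ge0_le_integral => //=.
  - by move=> u _; rewrite lee_fin powR_ge0.
  - apply/measurable_EFinP; by apply: measurable_funS (measurable_average_powR adm).
  move=> u; rewrite in_itv/= => /andP[u1 u2]; rewrite lee_fin.
  rewrite ler_pdivlMr ?powR_gt0//.
  have u0 : 0 < u by exact: lt_trans u1.
  have Au0 : 0 <= average g u by apply: (average_ge0 adm); lra.
  have At0 : 0 <= average g t by apply: (average_ge0 adm); lra.
  rewrite -(powRM p Au0 (ltW r0)).
  apply: (ge0_ler_powR p0 (mulr_ge0 Au0 (ltW r0)) At0).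
  rewrite /average mulrAC ler_pdivrMr// mulrAC ler_pdivlMr//.
  have Gut : primitive g u <= primitive g t.
    by apply: (admissible_primitive_le adm) => //; rewrite (ltW u0).
  have Gt0 : 0 <= primitive g t by apply: (admissible_primitive_ge0 adm); lra.
  rewrite -mulrA [r * t]mulrC; apply: ler_pM => //; last exact: ltW.
    by apply: (admissible_primitive_ge0 adm); lra.
  exact: ltW.
rewrite (integral_cst _ _ (_ : R)%:E)//= lebesgue_measure_itv/= lte_fin trt.
by rewrite -EFinD -EFinM.
Qed.

(** Monotone convergence along left endpoints tending to 0. It gives access to integrands that may
    be singular at 0. *)
Lemma cvg_integral_itv0 (h : R -> R) (k r : R) :
  0 < k -> 0 < r -> r < 1 ->
  measurable_fun `]0, k] h -> (forall x, 0 < x -> x <= k -> 0 <= h x) ->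
  (\int[mu]_(x in `](k * r ^+ n)%R, k]) (h x)%:E)%E @[n --> \oo] -->
  (\int[mu]_(x in `]0%R, k]) (h x)%:E)%E.
Proof.
move=> k0 r0 r1 mh h0.
have s0 n : 0 < k * r ^+ n by rewrite mulr_gt0 ?exprn_gt0.
have -> : `]0, k]%classic = \bigcup_n `](k * r ^+ n)%R, k]%classic.
  apply/seteqP; split => x /=; last first.
    by case=> n _ /=; rewrite !in_itv/= => /andP[/(lt_trans (s0 n)) ->].
  rewrite in_itv/= => /andP[x0 xk].
  have /cvgrPdist_lt/(_ (x / k)) : r ^+ n @[n --> \oo] --> 0.
    by apply: cvg_expr; rewrite gtr0_norm.
  rewrite divr_gt0// => /(_ isT)[n _ /(_ n (leqnn n))] /=.
  rewrite sub0r normrN gtr0_norm ?exprn_gt0// ltr_pdivlMr// => rn.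
  by exists n => //=; rewrite in_itv/= xk andbT mulrC.
apply: ge0_nondecreasing_set_cvg_integral => //.
- apply/nondecreasing_seqP => n; rewrite subsetEset.
  apply: subset_itvr; rewrite bnd_simp ler_pM2l// exprS ger_pMl ?exprn_gt0//.
  exact: ltW.
- move=> n; apply/measurable_EFinP; apply: measurable_funS mh => //.
  by apply: subset_itvr; rewrite bnd_simp ltW.
- move=> n x /=; rewrite in_itv/= => /andP[nx xk]; rewrite lee_fin h0//.
  exact: lt_trans nx.
Qed.

(* On the slab [](t * r), t]] the average exceeds [average g t] at most by the factor [r^-1],
   so summing [average_powR_step] over a geometric partition loses only the factor [r^p]. *)
Lemma integral_average_geometric (p f F a k r : R) (g : R -> R) (n : nat) :
  1 < p -> 1 < a -> admissible p f F g -> 0 < k -> k <= 1 -> 0 < r -> r < 1 ->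
  let s := k * r ^+ n in
  (\int[mu]_(t in `]s, k]) (average g t `^ p)%:E <=
   ((a `^ (p - 1) * (primitive (fun x => g x `^ p) k - primitive (fun x => g x `^ p) s)
     - k * average g k `^ p + s * average g s `^ p) /
    ((p - 1) * (1 - a^-1) * r `^ p))%:E)%E.
Proof.
move=> p1 a1 adm k0 k1 r0 r1 /=.
set c := (p - 1) * (1 - a^-1) * r `^ p.
have a0 : 0 < a by lra.
have c0 : 0 < c.
  by rewrite !mulr_gt0 ?powR_gt0 ?subr_gt0 ?invf_lt1.
elim: n => [|n IH].
  rewrite expr0 mulr1 set_itv_ge ?bnd_simp ?ltxx// integral_set0 lee_fin.
  by rewrite subrr mulr0 sub0r addNr mul0r.
set s := k * r ^+ n in IH *.
have s0 : 0 < s by rewrite mulr_gt0 ?exprn_gt0.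
have sk : s <= k by rewrite ger_pMr// exprn_ile1// ltW.
have s1 : s <= 1 by exact: le_trans k1.
rewrite exprSr mulrA -/s.
have srs : s * r < s by rewrite gtr_pMr.
have sr0 : 0 < s * r by exact: mulr_gt0.
have sub : `]s * r, k] `<=` `]0, 1] by move=> u /=; rewrite !in_itv/=; lra.
have mA : measurable_fun `](s * r)%R, k] (fun t => (average g t `^ p)%:E).
  by apply/measurable_EFinP; apply: measurable_funS (measurable_average_powR adm).
have E : `]s * r, k]%classic = `]s * r, s] `|` `]s, k].
  by rewrite -itv_bndbnd_setU// bnd_simp// ltW.
rewrite E ge0_integral_setU//=; last 3 first.
- by rewrite -E.
- by move=> x _; rewrite lee_fin powR_ge0.
- apply/disj_setPS => y [/=]; rewrite !in_itv/= => /andP[_ ys] /andP[].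
  by rewrite ltNge ys.
have H := integral_average_slab p1 adm r0 r1 s0 s1.
apply: (le_trans (leeD H IH)); rewrite -EFinD lee_fin.
(* Divided by [c], the step on []s * r, s]] telescopes with the induction hypothesis: the term in
   [average g s] is exchanged for the one at [s * r]. *)
have := average_powR_step p1 a0 adm sr0 (ltW srs) s1.
rewrite -(ler_pM2r (x := c^-1)) ?invr_gt0//.
set q := a `^ (p - 1); set Q0 := primitive _ s; set Q1 := primitive _ (s * r).
set Q2 := primitive _ k.
have -> : average g s `^ p / r `^ p * (s - s * r) =
  ((p - 1) * (1 - a^-1) * average g s `^ p * (s - s * r)) / c.
  by rewrite /c; field; rewrite !gt_eqF ?powR_gt0 ?subr_gt0.
lra.
Qed.

(** Two limits in the geometric estimate: first the number of slabs tends to infinity for fixed [r],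
    then [r] tends to 1, the latter as an argument by contradiction. *)
Lemma hardy_functional_le (p f F a k : R) (g : R -> R) :
  1 < p -> 1 < a -> admissible p f F g -> 0 < k -> k <= 1 ->
  (((p - 1) * (1 - a^-1))%:E * hardy_functional p k g <=
   (a `^ (p - 1) * primitive (fun x => g x `^ p) k - k * average g k `^ p)%:E)%E.
Proof.
move=> p1 a1 adm k0 k1.
rewrite (hardy_functionalE adm k1).
set c := (p - 1) * (1 - a^-1); set B := a `^ (p - 1) * _ - _.
have a0 : 0 < a by lra.
have p0 : 0 < p by lra.
have c0 : 0 < c by rewrite mulr_gt0 ?subr_gt0 ?invf_lt1.
set I := (\int[mu]_(t in _) _)%E.
have I0 : (0 <= I)%E by apply: integral_ge0 => t _; rewrite lee_fin powR_ge0.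
have IB r : 0 < r -> r < 1 -> (I <= (B / (c * r `^ p))%:E)%E.
  move=> r0 r1.
  have mA : measurable_fun `]0%R, k] (fun t => average g t `^ p).
    apply: measurable_funS (measurable_average_powR adm) => //.
    by apply: subset_itvl; rewrite bnd_simp.
  have := cvg_integral_itv0 k0 r0 r1 mA (fun x _ _ => powR_ge0 (average g x) p).
  move=> IC; rewrite /I -(cvg_lim _ IC)//; apply: lime_le.
    by apply/cvg_ex; eexists; exact: IC.
  apply: nearW => n.
  apply: (le_trans (integral_average_geometric n p1 a1 adm k0 k1 r0 r1)).
  have crp0 : 0 <= (c * r `^ p)^-1.
    by rewrite invr_ge0; exact: (mulr_ge0 (ltW c0) (powR_ge0 _ _)).
  rewrite lee_fin; apply: (ler_wpM2r crp0).
  (* The remainder [s A(s)^p - a^(p-1) int_0^s g^p] is nonpositive, by Jensen and [a^(p-1) >= 1]. *)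
  set s := k * r ^+ n.
  have s0 : 0 < s by rewrite mulr_gt0 ?exprn_gt0.
  have sk : s <= k by rewrite ger_pMr// exprn_ile1// ltW.
  have sQ := average_powR_le p1 adm s0 (le_trans sk k1).
  have q1 : 1 <= a `^ (p - 1) by rewrite -[X in X <= _](powRr0 a); apply: ler_powR; lra.
  have Q0 : 0 <= primitive (fun x => g x `^ p) s.
    by apply: Rintegral_ge0 => x _; exact: powR_ge0.
  have := ler_wpM2r Q0 q1; rewrite mul1r /B mulrBr; lra.
clearbody c B.
have h0 : (0 : R) < 2^-1 by lra.
have h1 : (2^-1 : R) < 1 by lra.
(* The ratio [r = 1/2] already gives finiteness, so real arithmetic is available from here. *)
have Ifin : I \is a fin_num.
  by rewrite ge0_fin_numE//; exact: le_lt_trans (IB _ h0 h1) (ltry _).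
move: I I0 Ifin IB => [i|//|//] /= i0 _ IB.
rewrite -EFinM lee_fin; rewrite lee_fin in i0.
rewrite leNgt; apply/negP => Bci.
have B0 : 0 <= B.
  have := IB _ h0 h1; rewrite lee_fin ler_pdivlMr ?mulr_gt0 ?powR_gt0//.
  by apply: le_trans; exact: (mulr_ge0 i0 (mulr_ge0 (ltW c0) (powR_ge0 _ _))).
have ci0 : 0 < c * i by exact: le_lt_trans B0 Bci.
(* [rho] is the midpoint of [B / (c * i)] and 1. For [r = rho^(1/p)] the bound reads
   [(B + c * i) / 2 <= B], against [B < c * i]. *)
set rho := (B + c * i) / (2 * (c * i)).
have rho0 : 0 < rho by rewrite divr_gt0//; lra.
have rho1 : rho < 1 by rewrite ltr_pdivrMr; lra.
have rhop1 : rho `^ p^-1 < 1.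
  have E1 : 1 `^ p^-1 = 1 :> R by rewrite powR1.
  by rewrite -[X in _ < X]E1 gt0_ltr_powR ?invr_gt0 ?nnegrE// ltW.
have := IB _ (powR_gt0 p^-1 rho0) rhop1.
rewrite lee_fin -powRrM mulVf ?gt_eqF// (powRr1 (ltW rho0)).
rewrite (ler_pdivlMr _ _ (mulr_gt0 c0 rho0)).
have -> : i * (c * rho) = (B + c * i) / 2.
  by rewrite /rho; field; rewrite !gt_eqF// -(pmulr_rgt0 i c0).
lra.
Qed.

End hardy_bound.

(** * Extremal functions *)

Section extremal.
Context {R : realType}.
Notation mu := (@lebesgue_measure R).

Lemma powR_continuous (c x : R) : 0 < x -> {for x, continuous (@powR R ^~ c)}.
Proof.
move=> x0; apply/differentiable_continuous/derivable1_diffP.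
by apply: derivable_powR; rewrite in_itv/= x0.
Qed.

Lemma integral_powR_itv (c s t : R) : -1 < c -> 0 < s -> s < t ->
  (\int[mu]_(x in `]s, t]) (x `^ c)%:E =
   (t `^ (c + 1) / (c + 1) - s `^ (c + 1) / (c + 1))%:E)%E.
Proof.
move=> c1 s0 st; have c0 : 0 < c + 1 by lra.
rewrite integral_itv_obnd_cbnd; last first.
  by apply/measurable_EFinP; apply: measurable_funTS; exact: measurable_powR.
have t0 : 0 < t by exact: lt_trans st.
have F'c (x : R) : 0 < x -> is_derive x 1 (fun y => y `^ (c + 1) / (c + 1)) (x `^ c).
  move=> x0.
  have -> : (fun y : R => y `^ (c + 1) / (c + 1)) =
      (c + 1)^-1 \*: (fun y : R => y `^ (c + 1)).
    by apply/funext => y /=; rewrite mulrC.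
  have -> : x `^ c = (c + 1)^-1 *: ((c + 1) * x `^ (c + 1 - 1)).
    by rewrite addrK /GRing.scale/= mulrA mulVf ?mul1r// gt_eqF.
  by apply: is_deriveZ; apply: is_derive1_powR.
have cF (x : R) : 0 < x -> {for x, continuous (fun y : R => y `^ (c + 1) / (c + 1))}.
  move=> x0; apply/differentiable_continuous/derivable1_diffP.
  by have [] := F'c _ x0.
rewrite (@continuous_FTC2 _ _ (fun y => y `^ (c + 1) / (c + 1)))//.
- by apply: continuous_in_subspaceT => x; rewrite inE/= in_itv/= => /andP[sx _];
    apply: powR_continuous; exact: lt_le_trans sx.
- split.
  + move=> x; rewrite in_itv/= => /andP[sx _].
    by have [] := F'c x (lt_trans s0 sx).
  + by apply: cvg_at_right_filter; exact: cF.
  + by apply: cvg_at_left_filter; exact: cF.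
- move=> x; rewrite in_itv/= => /andP[sx _].
  have [dx Ex] := F'c x (lt_trans s0 sx).
  by rewrite derive1E Ex.
Qed.

(** For negative [c] the integrand is singular at 0, so the formula is first used on [](t * 2^-n),
    t]]; the contribution of the lower endpoint is geometric with ratio [2^-(c+1) < 1]. *)
Lemma integral_powR_itv0 (c t : R) : -1 < c -> 0 < t ->
  (\int[mu]_(x in `]0%R, t]) (x `^ c)%:E = (t `^ (c + 1) / (c + 1))%:E)%E.
Proof.
move=> c1 t0; have c0 : 0 < c + 1 by lra.
have r0 : (0 : R) < 2^-1 by lra.
have r1 : (2^-1 : R) < 1 by lra.
have mc : measurable_fun `]0%R, t] (fun x : R => x `^ c).
  by apply: measurable_funTS; exact: measurable_powR.
have H := cvg_integral_itv0 t0 r0 r1 mc (fun x _ _ => powR_ge0 x c).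
apply/esym; apply: cvg_unique H => //.
apply: (@cvg_trans _ ((t `^ (c + 1) / (c + 1) -
    (t `^ (c + 1) / (c + 1)) * ((2^-1) `^ (c + 1)) ^+ n)%:E @[n --> \oo])).
  (* [integral_powR_itv] requires a nondegenerate interval, which excludes [n = 0]. *)
  apply: near_eq_cvg; near=> n.
  rewrite integral_powR_itv ?mulr_gt0 ?exprn_gt0//; last first.
    rewrite gtr_pMr// exprn_ilt1 ?ltW//.
    by rewrite -lt0n; near: n; exact: nbhs_infty_gt.
  rewrite powRM ?exprn_ge0 ?ltW// -powR_mulrn ?(ltW r0)// powRAC.
  by rewrite powR_mulrn ?powR_ge0// mulrAC.
apply: cvg_EFin; first by near=> n.
rewrite -[X in _ --> X]subr0 -[X in _ --> _ - X](mulr0 (t `^ (c + 1) / (c + 1))).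
apply: cvgB; first exact: cvg_cst.
apply: cvgMr; apply: cvg_expr.
rewrite ger0_norm ?powR_ge0//.
have E1 : 1 `^ (c + 1) = 1 :> R by rewrite powR1.
by rewrite -[X in _ < X]E1 gt0_ltr_powR ?nnegrE// ltW.
Unshelve. all: by end_near. Qed.

(** The extremal shape, normalised to be 1 from [k] on. Its powers are again profiles, so both
    integral constraints reduce to [integral_profile1]. *)
Definition profile (k c x : R) : R := (Num.min x k / k) `^ c.

Lemma measurable_profile (k c : R) (D : set R) : measurable_fun D (profile k c).
Proof.
apply: measurable_funTS; apply: (measurableT_comp (measurable_powR c)).
by apply: measurable_funM => //; exact: measurable_minr.
Qed.

Lemma integral_profile_le (k c t : R) : -1 < c -> 0 < t -> t <= k ->
  (\int[mu]_(x in `]0%R, t]) (profile k c x)%:E = (t * (t / k) `^ c / (c + 1))%:E)%E.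
Proof.
move=> c1 t0 tk; have k0 : 0 < k by exact: lt_le_trans tk.
have ki0 : 0 <= k^-1 by rewrite invr_ge0 ltW.
transitivity (\int[mu]_(x in `]0%R, t]) ((k^-1 `^ c)%:E * (x `^ c)%:E))%E.
  apply: eq_integral => x; rewrite inE/= in_itv/= => /andP[x0 xt].
  by rewrite /profile min_l ?(le_trans xt)// powRM ?(ltW x0)// mulrC.
rewrite ge0_integralZl_EFin//=; last 3 first.
- by move=> x _; rewrite lee_fin powR_ge0.
- by apply/measurable_EFinP; apply: measurable_funTS; exact: measurable_powR.
- exact: powR_ge0.
rewrite integral_powR_itv0// -EFinM; congr EFin.
rewrite powRM ?(ltW t0)// -(mulr_powRB1 (x := t) (p := c + 1)) ?(ltW t0)//; last by lra.
by rewrite addrK; ring.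
Qed.

Lemma integral_profile1 (k c : R) : -1 < c -> 0 < k -> k <= 1 ->
  (\int[mu]_(x in `]0%R, 1%R]) (profile k c x)%:E = (k / (c + 1) + (1 - k))%:E)%E.
Proof.
move=> c1 k0 k1.
have E : `]0, 1]%classic = `]0, k] `|` `]k, 1] by rewrite -itv_bndbnd_setU// bnd_simp ltW.
rewrite E ge0_integral_setU//=; last 3 first.
- by apply/measurable_EFinP; exact: measurable_profile.
- by move=> x _; rewrite lee_fin powR_ge0.
- apply/disj_setPS => y [/=]; rewrite !in_itv/= => /andP[_ ys] /andP[].
  by rewrite ltNge ys.
rewrite integral_profile_le// divff ?gt_eqF// powR1 mulr1 EFinD; congr (_ + _)%E.
transitivity (\int[mu]_(x in `]k, 1%R]) (1 : R)%:E)%E.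
  apply: eq_integral => x; rewrite inE/= in_itv/= => /andP[kx x1].
  by rewrite /profile min_r ?(ltW kx)// divff ?gt_eqF// powR1.
rewrite (integral_cst _ _ (_ : R)%:E)//= mul1e lebesgue_measure_itv/= lte_fin.
by case: ltP => // k1'; congr EFin; lra.
Qed.

Lemma profile_powR (k c p x : R) : profile k c x `^ p = profile k (c * p) x.
Proof. by rewrite /profile powRrM. Qed.

Lemma profile_nonincreasing (k c x y : R) : 0 < k -> c <= 0 -> 0 < x -> x <= y ->
  profile k c y <= profile k c x.
Proof.
move=> k0 c0 x0 xy; have y0 : 0 < y by exact: lt_le_trans xy.
have mx : 0 < Num.min x k / k by rewrite divr_gt0// lt_min x0.
rewrite /profile -(opprK c) 2!(powRN _ (- c)) lef_pV2 ?posrE ?powR_gt0//; last first.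
  by rewrite divr_gt0// lt_min y0.
apply: ge0_ler_powR; rewrite ?nnegrE ?oppr_ge0 ?(ltW mx)//.
  by rewrite divr_ge0 ?(ltW k0)// le_min ?(ltW y0) ?(ltW k0).
rewrite ler_wpM2r ?invr_ge0 ?(ltW k0)//.
by rewrite le_min ge_min xy/= ge_min lexx orbT.
Qed.

Lemma profile_continuous (k c x : R) : 0 < k -> 0 < x ->
  {for x, continuous (profile k c)}.
Proof.
move=> k0 x0; rewrite /profile.
apply: (@continuous_comp _ _ _ (fun y : R => Num.min y k / k) (@powR R ^~ c)); last first.
  by apply: powR_continuous; rewrite divr_gt0// lt_min x0.
by apply: cvgMl; apply: continuous_min; [exact: cvg_id|exact: cvg_cst].
Qed.

End extremal.

(** * Sharp bound, equality case and choice of the parameters *)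

Section optimality.
Context {R : realType}.
Notation mu := (@lebesgue_measure R).

(** The equations for [f] and [F] are the constraints met by [M] times a profile, and the bound is
    the value of the functional there. The [p]-th power of that profile has exponent [d - 1], whence
    [k / d]. *)
Lemma hardy_functional_le_max (p f F a d M k : R) (g : R -> R) :
  1 < p -> 1 < a -> 0 < d -> a * (p - 1 + d) = p -> 0 <= M -> 0 < k -> k <= 1 ->
  f = M * (a * k + 1 - k) -> F = M `^ p * (k / d + 1 - k) ->
  admissible p f F g ->
  (hardy_functional p k g <= (a `^ p * M `^ p * (k / d))%:E)%E.
Proof.
move=> p1 a1 d0 ad M0 k0 k1 fE FE adm.
have a0 : 0 < a by lra.
have p0 : 0 < p by lra.
have c0 : 0 < (p - 1) * (1 - a^-1) by rewrite mulr_gt0 ?subr_gt0 ?invf_lt1.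
rewrite -(@lee_pmul2l _ ((p - 1) * (1 - a^-1))%:E) ?lte_fin//.
apply: (le_trans (hardy_functional_le p1 a1 adm k0 k1)).
rewrite -EFinM lee_fin.
have k01 : 0 <= k <= 1 by rewrite ltW.
have := young_increment p1 adm k01 (lexx 1) M0.
rewrite (admissible_primitive1 adm) (admissible_primitive_powR1 adm).
have Ak0 : 0 <= average g k by apply: (average_ge0 adm) => //; exact: ltW.
have := powR_tangent p1 Ak0 (mulr_ge0 (ltW a0) M0).
have kE : primitive g k = k * average g k by rewrite /average mulrC divfK ?gt_eqF.
rewrite kE !(powRM _ (ltW a0) M0) FE [X in X - k * average g k]fE.
have aM : a `^ p = a * a `^ (p - 1) by rewrite mulr_powRB1 ?(ltW a0).
have MM : M `^ p = M * M `^ (p - 1) by rewrite mulr_powRB1.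
rewrite aM MM.
set x := average g k; set Qk := primitive _ k.
set q := a `^ (p - 1); set m := M `^ (p - 1).
have q0 : 0 <= q by exact: powR_ge0.
move=> T1 T2.
(* With weights [k] and [q] the two terms linear in [x], the unknown average at [k], cancel. *)
have {}T1 := ler_wpM2l (ltW k0) T1.
have {}T2 := ler_wpM2l q0 T2.
have -> : (p - 1) * (1 - a^-1) * (a * q * (M * m) * (k / d)) =
    q * (M * m) * k * ((1 - a * d) / d).
  rewrite (_ : 1 - a * d = (p - 1) * (a - 1)); last by lra.
  by field; rewrite !gt_eqF.
have -> : (1 - a * d) / d = d^-1 - a by field; rewrite gt_eqF.
lra.
Qed.

(** Covers [a = 1], where the factor [(p-1)(1-1/a)] of [hardy_functional_le] vanishes. *)
Lemma average_eq_const (p f : R) (g : R -> R) (t : R) :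
  1 < p -> 0 < f -> admissible p f (f `^ p) g -> 0 < t -> t <= 1 ->
  average g t = f.
Proof.
move=> p1 f0 adm t0 t1.
have ig := admissible_integrable adm.
have iP := admissible_powR_integrable adm.
have mg := admissible_measurable adm.
(* [phi] is the gap in Young's inequality at [y = f]. It is nonnegative with integral
   [f^p + (p-1) f^p - p f^p = 0], hence zero almost everywhere. *)
pose phi x := g x `^ p + (p - 1) * f `^ p - p * (g x * f `^ (p - 1)).
have g0 x : `]0, 1]%classic x -> 0 <= g x.
  by case: adm => + _ _ _ xI; apply; rewrite inE.
have phi0 x : `]0, 1]%classic x -> 0 <= phi x.
  by move=> /g0 gx; rewrite subr_ge0; apply: powR_tangent => //; exact: ltW.
have mu01 : mu `]0, 1] = 1%:E.
  by rewrite lebesgue_measure_itv/= lte_fin ltr01 -EFinD subr0.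
have mP := measurableT_comp (measurable_powR p) mg.
have mphi : measurable_fun `]0, 1 : R] phi.
  apply: measurable_funB; first exact: measurable_funD.
  by apply: measurable_funM => //; exact: measurable_funM.
have ic c : mu.-integrable `]0, 1] (EFin \o (fun=> c)).
  apply/integrableP; split; first exact/measurable_EFinP.
  by rewrite (integral_cst _ _ (`|c|%:E)%E)//= mu01 -EFinM ltry.
have cst01 c : (\int[mu]_(x in `]0%R, 1%R]) c%:E = c%:E)%E.
  by rewrite (integral_cst _ _ (_ : R)%:E)//= mu01 mule1.
have phiE : (\int[mu]_(x in `]0%R, 1%R]) `|(phi x)%:E| = 0)%E.
  transitivity (\int[mu]_(x in `]0%R, 1%R])
    (((g x `^ p)%:E + ((p - 1) * f `^ p)%:E) - (p * f `^ (p - 1))%:E * (g x)%:E))%E.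
    apply: eq_integral => x; rewrite inE => xI.
    rewrite gee0_abs; last by rewrite lee_fin; exact: phi0.
    by rewrite -EFinM -!EFinD; congr EFin; rewrite /phi; ring.
  case: (adm) => _ _ gf gF.
  rewrite integralB//; last 2 first.
  - exact: integrableD iP (ic _).
  - exact: integrableZl ig.
  rewrite integralD//; last exact: (ic ((p - 1) * f `^ p)).
  rewrite [X in (_ - X)%E](integralZl _ ig)// gf gF cst01.
  rewrite -EFinM -!EFinD; congr EFin.
  by rewrite -mulrA [_ * f]mulrC mulr_powRB1 ?(ltW f0)//; lra.
have ae := (ae_eq_integral_abs mu (measurable_itv _) (proj2 (measurable_EFinP _ _) mphi)).1 phiE.
have aeg : ae_eq mu `]0, t]%classic (EFin \o g) (EFin \o (fun=> f)).
  apply: filterS ae => x /= H; rewrite in_itv/= => /andP[x0 xt].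
  have xI : `]0, 1]%classic x by rewrite /= in_itv/= x0 (le_trans xt).
  have [phix] := H xI.
  congr EFin; apply/eqP/negPn/negP => gf.
  have := powR_tangent_lt p1 (g0 _ xI) f0 gf.
  by rewrite -subr_gt0 -/(phi x) phix ltxx.
have sub : `]0, t] `<=` `]0, 1 : R] by apply: subset_itvl; rewrite bnd_simp.
have E : (\int[mu]_(x in `]0%R, t]) (g x)%:E = (f * t)%:E)%E.
  rewrite (ae_eq_integral _ _ _ _ _ aeg)//=.
  - rewrite (integral_cst _ _ (_ : R)%:E)//= lebesgue_measure_itv/= lte_fin t0.
    by rewrite -EFinD subr0.
  - by apply/measurable_EFinP; exact: measurable_funS mg.
  - exact/measurable_EFinP.
by rewrite /average /primitive /Rintegral E /= mulfK ?gt_eqF.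
Qed.

(* [d] stands for [1 - p + p / a], which ranges over ]]0, 1]] when [1 <= a < p / (p - 1)];
   clearing the denominator [d] gives a function continuous up to [d = 0]. *)
Lemma exists_extremal_exponent (p f F k : R) :
  1 < p -> 0 < f -> f `^ p <= F -> 0 < k -> k <= 1 ->
  exists d, [/\ 0 < d, d <= 1 &
    F * (p / (p - 1 + d) * k + 1 - k) `^ p = f `^ p * (k / d + 1 - k)].
Proof.
move=> p1 f0 fF k0 k1.
have fp0 : 0 < f `^ p by exact: powR_gt0.
pose h d := f `^ p * (k + (1 - k) * d) - F * d * (p / (p - 1 + d) * k + 1 - k) `^ p.
have h0 : h 0 = f `^ p * k by rewrite /h; ring.
have h1 : h 1 = f `^ p - F.
  rewrite /h subrK divff; last by rewrite gt_eqF//; lra.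
  by rewrite (_ : 1 * k + 1 - k = 1) ?powR1; ring.
have ch : {within `[0, 1], continuous h}.
  apply: continuous_in_subspaceT => x; rewrite inE/= in_itv/= => /andP[x0 x1].
  have px0 : 0 < p - 1 + x by lra.
  have cx (c : R) : {for x, continuous (fun=> c)} by exact: cvg_cst.
  have ci : {for x, continuous (fun y : R => y)} by exact: cvg_id.
  apply: cvgB.
    by apply: cvgM; [exact: cx|apply: cvgD; [exact: cx|apply: cvgM; [exact: cx|exact: ci]]].
  apply: cvgM; first by apply: cvgM; [exact: cx|exact: ci].
  apply: (@continuous_comp _ _ _ (fun y : R => p / (p - 1 + y) * k + 1 - k) (@powR R ^~ p)).
    apply: cvgB; last exact: cx.
    apply: cvgD; last exact: cx.
    apply: cvgM; last exact: cx.
    apply: cvgM; first exact: cx.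
    by apply: cvgV; [rewrite gt_eqF|apply: cvgD; [exact: cx|exact: ci]].
  apply: powR_continuous.
  have : 0 < p / (p - 1 + x) * k by rewrite !mulr_gt0 ?invr_gt0//; lra.
  lra.
have [||d] := IVT (v := 0) _ ch; first exact: ler01.
  rewrite h0 h1 ge_min le_max; apply/andP; split; apply/orP; [right|left].
    by rewrite subr_le0.
  by rewrite mulr_ge0 ?ltW.
rewrite in_itv/= => /andP[d0 d1] hd.
(* [h 0 = f^p * k] is positive, so the root is not 0 and the cleared denominator can be restored. *)
have {}d0 : 0 < d.
  rewrite lt0r d0 andbT; apply/eqP => d00.
  by move: hd; rewrite d00 h0 => /eqP; rewrite mulf_eq0 !gt_eqF.
exists d; split => //.
apply: (mulfI (lt0r_neq0 d0)).
rewrite [RHS](_ : _ = f `^ p * (k + (1 - k) * d)); last by field; rewrite gt_eqF.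
by move: hd; rewrite /h => /eqP; rewrite subr_eq0 => /eqP ->; ring.
Qed.

(** The exponent [(d - 1) / p] equals [1/a - 1], so on []0, k]] the average of [g] is exactly
    [a * g]: the equality case of Young's inequality at the average divided by [a]. *)
Lemma extremal_functionalE (p f F a d M k : R) :
  1 < p -> 0 < d -> d <= 1 -> a * (p - 1 + d) = p -> 0 <= M -> 0 < k -> k <= 1 ->
  f = M * (a * k + 1 - k) -> F = M `^ p * (k / d + 1 - k) ->
  let g x := M * profile k ((d - 1) / p) x in
  admissible p f F g /\ hardy_functional p k g = (a `^ p * M `^ p * (k / d))%:E.
Proof.
move=> p1 d0 d1 ad M0 k0 k1 fE FE /=.
set b := (d - 1) / p; set g := fun x => M * profile k b x.
have p0 : 0 < p by lra.
have bp : b * p = d - 1 by rewrite /b divfK ?gt_eqF.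
have b1E : b + 1 = a^-1.
  have pd : p - 1 + d != 0 by rewrite gt_eqF//; lra.
  have a0 : a != 0 by apply: contraTneq p0 => a0; rewrite -ad a0 mul0r ltxx.
  apply: (mulIf a0); rewrite mulVf//; apply: (mulIf pd).
  by rewrite -mulrA ad mul1r mulrDl bp; lra.
have a0 : 0 < a by rewrite -invr_gt0 -b1E -(pmulr_lgt0 _ p0) mulrDl bp; lra.
have b1 : -1 < b by rewrite -subr_gt0 opprK b1E invr_gt0.
have b0 : b <= 0 by rewrite /b ler_pdivrMr// mul0r; lra.
have gpE x : g x `^ p = M `^ p * profile k (d - 1) x.
  by rewrite powRM ?powR_ge0// profile_powR bp.
have adm : admissible p f F g.
  split.
  - by move=> x _; rewrite mulr_ge0 ?powR_ge0.
  - move=> x y; rewrite !inE/= !in_itv/= => /andP[x0 _] _ xy.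
    by apply: ler_wpM2l => //; exact: profile_nonincreasing.
  - under eq_integral do rewrite EFinM.
    rewrite ge0_integralZl_EFin//=; last 2 first.
    + by move=> x _; rewrite lee_fin powR_ge0.
    + by apply/measurable_EFinP; exact: measurable_profile.
    rewrite integral_profile1// b1E invrK -EFinM fE; congr EFin; ring.
  - under eq_integral do rewrite gpE EFinM.
    rewrite ge0_integralZl_EFin//=; last 3 first.
    + by move=> x _; rewrite lee_fin powR_ge0.
    + by apply/measurable_EFinP; exact: measurable_profile.
    + exact: powR_ge0.
    rewrite integral_profile1//; last by lra.
    by rewrite subrK -EFinM FE; congr EFin; ring.
split => //; rewrite (hardy_functionalE adm k1).
have avgE t : 0 < t -> t <= k -> average g t = a * M * profile k b t.
  move=> t0 tk; rewrite /average /primitive /Rintegral.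
  under eq_integral do rewrite EFinM.
  rewrite ge0_integralZl_EFin//=; last 2 first.
  + by move=> x _; rewrite lee_fin powR_ge0.
  + by apply/measurable_EFinP; exact: measurable_profile.
  rewrite integral_profile_le// -EFinM/= b1E invrK /profile min_l//.
  by field; rewrite gt_eqF.
transitivity (\int[mu]_(t in `]0%R, k]) ((a `^ p * M `^ p)%:E * (profile k (d - 1) t)%:E))%E.
  apply: eq_integral => t; rewrite inE/= in_itv/= => /andP[t0 tk].
  rewrite avgE// powRM ?mulr_ge0 ?powR_ge0 ?(ltW a0)// powRM ?(ltW a0)//.
  by rewrite profile_powR bp EFinM.
rewrite ge0_integralZl_EFin//=; last 3 first.
+ by move=> x _; rewrite lee_fin powR_ge0.
+ by apply/measurable_EFinP; exact: measurable_profile.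
+ by rewrite mulr_ge0 ?powR_ge0.
rewrite integral_profile_le//; last by lra.
by rewrite divff ?gt_eqF// powR1 mulr1 subrK -EFinM.
Qed.

End optimality.

(** * Attainment of the supremum *)

Unset Implicit Arguments.

Theorem theorem1p2 (R : realType) (p f F k : R) :
  1 < p -> 0 < f -> powR f p <= F -> 0 < k -> k <= 1 ->
  exists g : R -> R,
    admissible p f F g /\
    {within `]0%R, 1%R]%classic, continuous g} /\
    hardy_functional p k g = S_k p k f F.
Proof.
move=> p1 f0 fF k0 k1.
have [d [d0 d1 dE]] := exists_extremal_exponent p1 f0 fF k0 k1.
have pd : 0 < p - 1 + d by lra.
set a := p / (p - 1 + d) in dE.
have ad : a * (p - 1 + d) = p by rewrite /a divfK ?gt_eqF.
have a0 : 0 < a by rewrite divr_gt0//; lra.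
have D0 : 0 < a * k + 1 - k by have := mulr_gt0 a0 k0; lra.
(* [M] is forced by the integral of [g]; the equation defining [d] then yields the integral of
   [g^p]. *)
set M := f / (a * k + 1 - k).
have M0 : 0 <= M by rewrite divr_ge0 ?ltW.
have fE : f = M * (a * k + 1 - k) by rewrite /M divfK ?gt_eqF.
have FE : F = M `^ p * (k / d + 1 - k).
  have Dp : (a * k + 1 - k) `^ p != 0 by rewrite gt_eqF// powR_gt0.
  by apply: (mulIf Dp); rewrite dE [in LHS]fE powRM ?(ltW D0)//; ring.
have [adm valE] := extremal_functionalE p1 d0 d1 ad M0 k0 k1 fE FE.
exists (fun x => M * profile k ((d - 1) / p) x); split => //; split.
  apply: continuous_in_subspaceT => x; rewrite inE/= in_itv/= => /andP[x0 _].
  by apply: cvgMr; exact: profile_continuous.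
apply/eqP; rewrite eq_le; apply/andP; split.
  by apply: ereal_sup_ubound; eexists; first exact: adm.
apply: ge_ereal_sup => _ [g admg <-]; rewrite valE.
(* [d < 1] amounts to [a > 1], the range of the sharp bound. In the remaining case [d = a = 1],
   [M = f] and [F = f^p], so every admissible function has constant average [f]. *)
have [d1'|d1'] := ltP d 1.
  apply: (hardy_functional_le_max p1 _ d0 ad M0 k0 k1 fE FE admg).
  by rewrite /a ltr_pdivlMr//; lra.
have {d1'}d1E : d = 1 by lra.
have a1 : a = 1 by rewrite /a d1E subrK divff// gt_eqF//; lra.
have MfE : M = f by rewrite /M a1 mul1r addrAC subrr add0r divr1.
have FfE : F = f `^ p by rewrite FE MfE d1E; field.
rewrite FfE in admg.
rewrite (hardy_functionalE admg k1).
rewrite (_ : (\int[_]_(t in _) _)%E = (\int[@lebesgue_measure R]_(t in `]0%R, k]) (f `^ p)%:E)%E).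
  rewrite (integral_cst _ _ (_ : R)%:E)//= lebesgue_measure_itv/= lte_fin k0.
  by rewrite a1 powR1 MfE d1E mul1r divr1 -EFinD subr0 -EFinM.
apply: eq_integral => t; rewrite inE/= in_itv/= => /andP[t0 tk].
by rewrite (average_eq_const p1 f0 admg)// (le_trans tk).
Qed.
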